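(* For every $k\in\mathbb{N}$, $k \geq 1$, there is no isometric embedding of $\ell^1(2)$ into $M_k$; that is, there is no $\mathbb{C}$-linear map $\phi:\ell^1(2)\to M_k$ satisfying $\|\phi(a_1,a_2)\| = |a_1|+|a_2|$ for all $(a_1,a_2)\in\mathbb{C}^2$.
   Context: All normed linear spaces are over $\mathbb{C}$. $\ell^1(2)$ denotes $\mathbb{C}^2$ with the norm $\|(a_1,a_2)\|_1=|a_1|+|a_2|$. $M_k$ denotes the space of $k\times k$ complex matrices with the operator norm (as operators on the Hilbert space $\mathbb{C}^k$ with its Euclidean norm). An isometric embedding is a linear norm-preserving map. *)

(* Defs.v *)
From mathcomp Require Import all_boot all_order all_algebra.
From mathcomp Require Import classical_sets reals complex.

Set Implicit Arguments.
Unset Strict Implicit.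
Unset Printing Implicit Defensive.

Import Order.TTheory GRing.Theory Num.Theory.
Import Normc.

Local Open Scope classical_set_scope.
Local Open Scope ring_scope.
Local Open Scope complex_scope.

(* [normc] is the modulus R[i] -> R, unlike [`|_|], which is R[i]-valued. *)
Definition l1norm (R : realType) (n : nat) (a : 'cV[R[i]]_n) : R :=
  \sum_(i < n) normc (a i 0).

Definition l2norm (R : realType) (n : nat) (v : 'cV[R[i]]_n) : R :=
  Num.sqrt (\sum_(i < n) normc (v i 0) ^+ 2).

Definition opnorm (R : realType) (k : nat) (A : 'M[R[i]]_k) : R :=
  sup [set l2norm (A *m v) | v in [set v : 'cV[R[i]]_k | l2norm v <= 1]].

(* The supremum above is genuine: [sup] is a junk 0 on sets without one. *)
Lemma opnorm_has_sup (R : realType) (k : nat) (A : 'M[R[i]]_k) :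
  has_sup [set l2norm (A *m v) | v in [set v : 'cV[R[i]]_k | l2norm v <= 1]].
Proof.
have n0 (z : R[i]) : 0 <= normc z by case: z => x y; exact: sqrtr_ge0.
have nsum (I : finType) (F : I -> R[i]) :
    normc (\sum_i F i) <= \sum_i normc (F i).
  elim/big_ind2: _ => [|x1 x2 y1 y2 h1 h2|//]; first by rewrite normc0.
  by apply: le_trans (le_normcD _ _) _; exact: lerD.
split.
  exists (l2norm (A *m 0)), 0 => //=.
  by rewrite /l2norm big1 ?sqrtr0 ?ler01// => i _; rewrite mxE normc0 expr0n.
exists (\sum_i \sum_j normc (A i j)) => _ [v /= v1 <-].
have vj j : normc (v j 0) <= 1.
  apply: le_trans v1; rewrite -[leLHS]ger0_norm// -sqrtr_sqr ler_wsqrtr//.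
  by rewrite (bigD1 j)//= lerDl sumr_ge0// => i _; rewrite sqr_ge0.
have l12 : l2norm (A *m v) <= \sum_i normc ((A *m v) i 0).
  have s0 : 0 <= \sum_i normc ((A *m v) i 0) by exact: sumr_ge0.
  rewrite -[leRHS]ger0_norm// -sqrtr_sqr ler_wsqrtr// [leRHS]expr2 mulr_suml.
  apply: ler_sum => i _; rewrite expr2 ler_wpM2l// (bigD1 i)//= lerDl.
  exact: sumr_ge0.
apply: le_trans l12 _; apply: ler_sum => i _; rewrite mxE.
apply: le_trans (nsum _ _) _; apply: ler_sum => j _.
by rewrite normcM ler_piMr.
Qed.

(* Main.v *)
Require Import Defs.
From mathcomp Require Import all_boot all_order all_algebra.
From mathcomp Require Import reals complex.
From mathcomp Require Import classical_sets ring lra.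

(** Write [A] and [B] for the images of the two basis vectors. They are
contractions, and [A + z B] has norm 2 for every [z] on the unit circle. If
that norm is attained at a unit vector [v], then [A v] and [z B v] are two
vectors of the unit ball whose sum has norm 2, so the parallelogram law forces
them to be equal unit vectors. A contraction [B] that preserves the norm of [v]
satisfies [B^* B v = v]; hence [B^* A v = z B^* B v = z v], and [z] is an
eigenvalue of [B^* A]. This makes the whole unit circle part of the spectrum of
one k x k matrix, whose characteristic polynomial has at most k roots.

The norm is a supremum, and compactness can be avoided by making the argument
quantitative: a vector at which [A + z B] almost reaches norm 2 is an
approximate eigenvector of [B^* A] (norm_attained_approx), and in finite
dimension approximate eigenvectors already produce an eigenvalue, because the
inverse of [B^* A - z] would be a bounded operator (eigenvalue_approx). All
estimates are on squared norms, so that they become linear arithmetic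
over R. *)

Set Implicit Arguments.
Unset Strict Implicit.
Unset Printing Implicit Defensive.

Import Order.TTheory GRing.Theory Num.Theory Normc.

Local Open Scope ring_scope.
Local Open Scope complex_scope.

(** * The Euclidean norm and its real inner product *)

Section Euclidean.
Variables (R : realType) (k : nat).
Implicit Types (u v w : 'cV[R[i]]_k) (M : 'M[R[i]]_k) (z : R[i]).

Definition adjmx M : 'M[R[i]]_k := map_mx (@conjc R) M^T.

(** The real part of the Hermitian product: a symmetric real bilinear form with
the same squared norm, whose values lie in the ordered field R. *)
Definition rdot u v : R := complex.Re ((map_mx (@conjc R) u^T *m v) 0 0).

Lemma ReD z1 z2 : complex.Re (z1 + z2 : R[i]) = complex.Re z1 + complex.Re z2.
Proof. by case: z1 z2 => [? ?] [? ?]. Qed.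

Lemma ReN z : complex.Re (- z) = - complex.Re z.
Proof. by case: z. Qed.

Lemma rdotDr u v w : rdot u (v + w) = rdot u v + rdot u w.
Proof. by rewrite /rdot mulmxDr mxE ReD. Qed.

Lemma rdotNr u v : rdot u (- v) = - rdot u v.
Proof. by rewrite /rdot mulmxN mxE ReN. Qed.

Lemma rdotC u v : rdot u v = rdot v u.
Proof.
rewrite /rdot !mxE; elim/big_rec2: _ => // i y1 y2 _; rewrite !ReD => ->.
by congr (_ + _); rewrite !mxE; case: (u i 0) (v i 0) => [a b] [c d] /=; ring.
Qed.

Lemma rdotDl u v w : rdot (u + v) w = rdot u w + rdot v w.
Proof. by rewrite !(rdotC _ w) rdotDr. Qed.

Lemma rdotNl u v : rdot (- u) v = - rdot u v.
Proof. by rewrite !(rdotC _ v) rdotNr. Qed.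

Lemma rdot_adj M u v : rdot u (adjmx M *m v) = rdot (M *m u) v.
Proof. by rewrite /rdot trmx_mul map_mxM /= mulmxA. Qed.

Lemma rdot_l2norm v : rdot v v = l2norm v ^+ 2.
Proof.
rewrite /l2norm sqr_sqrtr; last by apply: sumr_ge0 => i _; rewrite sqr_ge0.
rewrite /rdot mxE (big_morph (@complex.Re R) ReD (erefl _)).
apply: eq_bigr => i _; rewrite !mxE; case: (v i 0) => a b /=.
by rewrite sqr_sqrtr ?addr_ge0 ?sqr_ge0//; ring.
Qed.

Lemma l2norm_ge0 v : 0 <= l2norm v.
Proof. exact: sqrtr_ge0. Qed.

Lemma rdot_ge0 v : 0 <= rdot v v.
Proof. by rewrite rdot_l2norm sqr_ge0. Qed.

Lemma rdotZ z v : rdot (z *: v) (z *: v) = normc z ^+ 2 * rdot v v.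
Proof.
rewrite /rdot !mxE !(big_morph (@complex.Re R) ReD (erefl _)) mulr_sumr.
apply: eq_bigr => i _; rewrite !mxE; case: z (v i 0) => [c d] [a b] /=.
by rewrite sqr_sqrtr ?addr_ge0 ?sqr_ge0//; ring.
Qed.

Lemma rdot_eq0 v : rdot v v = 0 -> v = 0.
Proof.
rewrite rdot_l2norm /l2norm sqr_sqrtr; last first.
  by apply: sumr_ge0 => i _; rewrite sqr_ge0.
move=> /eqP; rewrite psumr_eq0; last by move=> i _; rewrite sqr_ge0.
move=> /allP v0; apply/colP => i; rewrite mxE.
by have := v0 i (mem_index_enum _); rewrite sqrf_eq0 => /eqP/eq0_normc.
Qed.

Lemma parallelogram u v :
  rdot (u + v) (u + v) + rdot (u - v) (u - v) = 2 * rdot u u + 2 * rdot v v.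
Proof.
by rewrite !(rdotDl, rdotDr, rdotNl, rdotNr) (rdotC v u); ring.
Qed.

Lemma rdotD_le u v : rdot (u + v) (u + v) <= 2 * rdot u u + 2 * rdot v v.
Proof. by rewrite -parallelogram lerDl rdot_ge0. Qed.

Lemma opnorm_bound M v :
  rdot (M *m v) (M *m v) <= opnorm M ^+ 2 * rdot v v.
Proof.
have [v0|v0] := eqVneq (rdot v v) 0.
  by rewrite (rdot_eq0 v0) mulmx0 /rdot mulmx0 mxE mulr0.
have lv : 0 < l2norm v.
  by rewrite lt_neqAle l2norm_ge0 andbT eq_sym -sqrf_eq0 -rdot_l2norm.
(* the unit vector in the direction of v competes in the supremum *)
pose c : R[i] := (l2norm v)^-1%:C.
have cE : normc c = (l2norm v)^-1.
  by rewrite /= expr0n addr0 sqrtr_sqr ger0_norm// invr_ge0 ltW.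
have nc : l2norm (c *: v) <= 1.
  have : l2norm (c *: v) ^+ 2 = 1.
    by rewrite -rdot_l2norm rdotZ cE rdot_l2norm -exprMn mulVf ?gt_eqF ?expr1n.
  by move/eqP; rewrite sqrp_eq1 ?l2norm_ge0// => /eqP ->.
have le : l2norm (M *m (c *: v)) <= opnorm M.
  by apply: sup_upper_bound; [exact: opnorm_has_sup|exists (c *: v)].
have : l2norm (M *m (c *: v)) ^+ 2 <= opnorm M ^+ 2.
  by rewrite ler_pXn2r// nnegrE ?l2norm_ge0// (le_trans (l2norm_ge0 _) le).
rewrite -rdot_l2norm -scalemxAr rdotZ cE exprVn mulrC.
by rewrite ler_pdivrMr ?exprn_gt0// -rdot_l2norm.
Qed.

(** The supremum defining the operator norm is approached by vectors of the
unit ball; this replaces a maximizing vector, whose existence would need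
compactness. *)
Lemma opnorm_approx M (c : R) : 0 <= c -> c < opnorm M ^+ 2 -> 0 <= opnorm M ->
  exists v, rdot v v <= 1 /\ c < rdot (M *m v) (M *m v).
Proof.
move=> c0 cM M0; have sM : Num.sqrt c < opnorm M.
  by rewrite -(ger0_norm M0) -sqrtr_sqr ltr_sqrt// (le_lt_trans c0 cM).
have [_ [v /= v1 <-] vM] := sup_gt (proj1 (opnorm_has_sup M)) sM.
exists v; split; first by rewrite rdot_l2norm expr_le1// l2norm_ge0.
by rewrite rdot_l2norm -(sqr_sqrtr c0) ltr_pXn2r// nnegrE ?sqrtr_ge0 ?l2norm_ge0.
Qed.

(** Quantitative form of: a contraction that preserves the norm of [v]
satisfies [M^* M v = v]. With [g = M^* M v], expanding the left side gives
[|v|^2 - 2 |M v|^2 + |g|^2], so the claim is [|g|^2 <= |M v|^2]. Now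
[<M v, M g> = |g|^2] gives [0 <= |M (v - g)|^2 = |M v|^2 - 2 |g|^2 + |M g|^2],
and [|M g| <= |g|]. *)
Lemma contraction_defect M v :
  (forall u, rdot (M *m u) (M *m u) <= rdot u u) ->
  rdot (v - adjmx M *m (M *m v)) (v - adjmx M *m (M *m v)) <=
    rdot v v - rdot (M *m v) (M *m v).
Proof.
move=> cM; set g := adjmx M *m (M *m v).
have vg u : rdot u g = rdot (M *m u) (M *m v) by rewrite rdot_adj.
have := cM g; have := rdot_ge0 (M *m (v - g)).
have -> : M *m (v - g) = M *m v - M *m g by rewrite mulmxBr.
rewrite !(rdotDl, rdotDr, rdotNl, rdotNr) (rdotC g v) !vg.
rewrite (rdotC (M *m v) (M *m g)); lra.
Qed.

End Euclidean.

(** * Unimodular eigenvalues *)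

Section Spectrum.
Variables (R : realType) (k : nat).
Implicit Types (A B M : 'M[R[i]]_k) (z : R[i]).

(** If [M - z] had an inverse [N] with [|N u|^2 <= c |u|^2], then the vectors
[v = N (M v - z v)] would have squared norm at most [c e], which is below 1/2
once [e] is small. *)
Lemma eigenvalue_approx M z :
    (forall e : R, 0 < e -> exists v : 'cV_k,
      1 <= 2 * rdot v v /\ rdot (M *m v - z *: v) (M *m v - z *: v) <= e) ->
  eigenvalue M z.
Proof.
move=> approx; apply: contraT.
rewrite /eigenvalue /eigenspace negbK kermx_eq0 row_free_unit => Tu.
pose N := invmx (M - z%:M).
have [c [c0 Nc]] : exists c : R, 0 <= c /\
    forall u, rdot (N *m u) (N *m u) <= c * rdot u u.
  by exists (opnorm N ^+ 2); split; [exact: sqr_ge0|exact: opnorm_bound].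
have e0 : 0 < (1 + 2 * c)^-1 by rewrite invr_gt0; lra.
have [v [v1 ve]] := approx _ e0.
have := Nc (M *m v - z *: v).
have -> : N *m (M *m v - z *: v) = v.
  by rewrite -mul_scalar_mx -mulmxBl mulmxA mulVmx// mul1mx.
have : c * rdot (M *m v - z *: v) (M *m v - z *: v) <= c * (1 + 2 * c)^-1.
  exact: ler_wpM2l.
have : (1 + 2 * c)^-1 + 2 * (c * (1 + 2 * c)^-1) = 1.
  by rewrite mulrA -{1}(mul1r (1 + 2 * c)^-1) -mulrDl mulfV// gt_eqF//; lra.
lra.
Qed.

(** Stability of the equality case of [|A v + z B v| <= 2]. The parallelogram
law bounds [d]; it also shows that [|B v|] is close to 1, so that
contraction_defect bounds [w]. *)
Lemma norm_attained_approx A B z v (e : R) :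
    (forall u, rdot (A *m u) (A *m u) <= rdot u u) ->
    (forall u, rdot (B *m u) (B *m u) <= rdot u u) ->
    normc z = 1 -> rdot v v <= 1 ->
    4 - e <= rdot ((A + z *: B) *m v) ((A + z *: B) *m v) ->
  let d := A *m v - z *: (B *m v) in
  let w := v - adjmx B *m (B *m v) in
  [/\ rdot d d <= e, 2 * rdot w w <= e & 2 - e <= 2 * rdot v v].
Proof.
move=> cA cB z1 v1; rewrite mulmxDl -scalemxAl => ABv d w.
have := parallelogram (A *m v) (z *: (B *m v)).
rewrite -/d rdotZ z1 expr1n mul1r.
have := cA v; have := cB v; have := rdot_ge0 d.
have : rdot w w <= rdot v v - rdot (B *m v) (B *m v).
  exact: contraction_defect.
by split; lra.
Qed.

(** With [d = A v - z B v] and [w = v - B^* B v], one has the identity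
[B^* A v - z v = B^* d - z w]: a vector at which [A + z B] almost attains its
norm is therefore an approximate eigenvector of [B^* A]. *)
Lemma unimodular_eigenvalue A B z :
    opnorm A = 1 -> opnorm B = 1 -> normc z = 1 -> opnorm (A + z *: B) = 2 ->
  eigenvalue (adjmx B *m A) z.
Proof.
move=> A1 B1 z1 AB2; apply: eigenvalue_approx => e e0.
have contr M : opnorm M = 1 ->
    forall u, rdot (M *m u) (M *m u) <= rdot u u.
  by move=> M1 u; have := opnorm_bound M u; rewrite M1 expr1n mul1r.
have [c [c0 Bc]] : exists c : R, 0 <= c /\
    forall u, rdot (adjmx B *m u) (adjmx B *m u) <= c * rdot u u.
  exists (opnorm (adjmx B) ^+ 2); split; [exact: sqr_ge0|exact: opnorm_bound].
(* h is the defect allowed in the norm: h <= 1 keeps v away from 0, and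
   (2 c + 1) h bounds the squared norm of B^* d - z w. *)
have [h [h0 h1 hc]] : exists h : R, [/\ 0 < h, h <= 1 & (2 * c + 1) * h <= e].
  have C0 : 0 < 2 * c + 1 by lra.
  exists (Num.min 1 (e / (2 * c + 1))); split.
  - by rewrite lt_min ltr01 divr_gt0.
  - by rewrite ge_min lexx.
  - by rewrite mulrC -ler_pdivlMr// ge_min lexx orbT.
have [v [v1 vh]] : exists v : 'cV_k, rdot v v <= 1 /\
    4 - h < rdot ((A + z *: B) *m v) ((A + z *: B) *m v).
  by apply: opnorm_approx; rewrite ?AB2; lra.
have [] := norm_attained_approx (contr _ A1) (contr _ B1) z1 v1 (ltW vh).
set d := _ - z *: _; set w := v - _ => dh wh vv.
exists v; split; first by lra.
have -> : adjmx B *m A *m v - z *: v = adjmx B *m d - z *: w.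
  by rewrite mulmxBr scalerBr -scalemxAr !mulmxA opprB addrA subrK.
rewrite -scaleNr; apply: le_trans (rdotD_le _ _) _.
rewrite rdotZ normcN z1 expr1n mul1r.
have := Bc d; have : c * rdot d d <= c * h by exact: ler_wpM2l.
by lra.
Qed.

(** The Cayley transform [m |-> (1 + i m) / (1 - i m)] is injective from the
real line to the unit circle; its values at integers suffice. *)
Lemma unit_circle_infinite n :
  exists s : seq R[i], [/\ size s = n, uniq s & all (fun z => normc z == 1) s].
Proof.
pose c (m : nat) : R[i] := 1 +i* m%:R.
have c0 m : c m != 0 by rewrite eq_complex /= negb_and oner_neq0.
have cJ0 m : (c m)^*%C != 0 by rewrite conjc_eq0 c0.
pose f m := c m / (c m)^*%C.
exists [seq f m | m <- iota 0 n]; split.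
- by rewrite size_map size_iota.
- rewrite map_inj_uniq ?iota_uniq// => m p /eqP.
  rewrite eqr_div// eq_complex /= => /andP[_ /eqP h].
  by apply/eqP; rewrite -(eqr_nat R); apply/eqP; lra.
- apply/allP => _ /mapP[m _ ->]; rewrite /f normcM normcV.
  have -> : normc (c m)^*%C = normc (c m) by rewrite /= sqrrN.
  by rewrite divff//; apply: contra (c0 m) => /eqP/eq0_normc ->.
Qed.

End Spectrum.

Theorem theorem2p2 (R : realType) (k : nat) (k_ge1 : (1 <= k)%N) :
  ~ exists phi : {linear 'cV[R[i]]_2 -> 'M[R[i]]_k},
      forall a : 'cV[R[i]]_2, opnorm (phi a) = l1norm a.
Proof.
case=> phi phiE.
pose A := phi (delta_mx 0 0); pose B := phi (delta_mx 1 0).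
have ABE x y : opnorm (x *: A + y *: B) = normc x + normc y.
  rewrite -!linearZ -linearD phiE /l1norm !big_ord_recl big_ord0 addr0.
  by congr (normc _ + normc _); rewrite !mxE/= ?mulr0 ?mulr1 ?addr0 ?add0r.
have A1 : opnorm A = 1.
  by have := ABE 1 0; rewrite scale1r scale0r !addr0 normc1 normc0 addr0.
have B1 : opnorm B = 1.
  by have := ABE 0 1; rewrite scale1r scale0r !add0r normc1 normc0 add0r.
have [s [sn su sz]] := unit_circle_infinite R k.+1.
have := max_poly_roots (monic_neq0 (char_poly_monic (adjmx B *m A))) _ su.
rewrite size_char_poly sn ltnn => /(_ _)/negP[]//.
apply/allP => z /(allP sz)/eqP z1; rewrite -eigenvalue_root_char.
apply: unimodular_eigenvalue => //.
by have := ABE 1 z; rewrite scale1r normc1 z1.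
Qed.
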